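(* Let $2\le q<\infty$, let $q'$ be given by $\frac1q+\frac1{q'}=1$, and let $X$ be a complex Banach space with Fourier cotype $q$. Then there exists $C>0$ such that for every $N\in\mathbb{N}$ and every finite family $(x_\alpha)_{\alpha\in\mathbb{N}_0^{N}}\subset X$ we have $$\Big(\sum_{\alpha}\|x_\alpha\|^q\Big)^{1/q}\le C\Big(\int_{\mathbb{T}^N}\Big\|\sum_\alpha x_\alpha z^\alpha\Big\|^{q'}dz\Big)^{1/q'}.$$ In particular, $X$ has hypercontractive homogeneous cotype $q$.
   Context: $\mathbb{T}=\{z\in\mathbb{C}:|z|=1\}$; $\mathbb{T}^N$ and $\mathbb{T}^\infty$ carry the product of the normalized Lebesgue measure on $\mathbb{T}$, denoted $dz$. For a finite multi-index $\alpha$ of nonnegative integers, $|\alpha|=\alpha_1+\alpha_2+\cdots$ and $z^\alpha=z_1^{\alpha_1}z_2^{\alpha_2}\cdots$. $\mathbb{N}_0^{(\mathbb{N})}$ is the set of all such finite multi-indices of arbitrary length. A finite family is a family with only finitely many nonzero elements (so any finite family indexed by $\mathbb{N}_0^{(\mathbb{N})}$ involves only multi-indices in some $\mathbb{N}_0^N$). Fourier cotype: $X$ has Fourier cotype $q$ ($2\le q<\infty$) if there is $C>0$ such that for every choice of finitely many vectors $x_1,\dots,x_N\in X$, $$\Big(\sum_{k=1}^N\|x_k\|^q\Big)^{1/q}\le C\Big(\int_{\mathbb{T}}\Big\|\sum_{k=1}^N x_kz^k\Big\|^{q'}dz\Big)^{1/q'}.$$ Hypercontractive homogeneous cotype: $X$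 has hypercontractive homogeneous cotype $q$ if there is $C>0$ such that for every $m\in\mathbb{N}$ and every finite family $(x_\alpha)_{|\alpha|=m}\subset X$, indexed by $\alpha\in\mathbb{N}_0^{(\mathbb{N})}$ with $|\alpha|=m$, $$\Big(\sum_{|\alpha|=m}\|x_\alpha\|^q\Big)^{1/q}\le C^m\Big(\int_{\mathbb{T}^\infty}\Big\|\sum_{|\alpha|=m}x_\alpha z^\alpha\Big\|^2dz\Big)^{1/2}.$$ *)

(* Defs.v *)
From HB Require Import structures.
From mathcomp Require Import all_boot all_order all_algebra.
From mathcomp Require Import finmap complex ring lra.
From mathcomp Require Import all_classical all_reals all_analysis measurable_realfun.

Set Implicit Arguments.
Unset Strict Implicit.
Unset Printing Implicit Defensive.

Import Order.TTheory GRing.Theory Num.Theory.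
Import numFieldNormedType.Exports.

Local Open Scope classical_set_scope.
Local Open Scope ring_scope.
Local Open Scope complex_scope.

Definition unit_circle (R : realType) : set R[i]^o := [set z | `|z| = 1].

Definition circle (R : realType) : Type := set_type (@unit_circle R).

Section circle.
Variable R : realType.

HB.instance Definition _ :=
  Topological.copy (circle R) (set_type (@unit_circle R)).

Lemma circle1_subproof : (1 : R[i]^o) \in @unit_circle R.
Proof. by rewrite inE /unit_circle /= normr1. Qed.

HB.instance Definition _ :=
  isPointed.Build (circle R) (exist _ (1 : R[i]^o) circle1_subproof).

HB.instance Definition _ :=
  Measurable.copy (circle R) (g_sigma_algebraType (@open (circle R))).

Definition cval (z : circle R) : R[i] := val z.

Definition expi (t : R) : R[i] := cos t +i* sin t.

Lemma arc_subproof (t : R) : (expi (2 * pi * t) : R[i]^o) \in @unit_circle R.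
Proof.
rewrite inE /unit_circle /= normc_def /=.
by rewrite cos2Dsin2 sqrtr1.
Qed.

Definition arc (t : R) : circle R := exist _ (expi (2 * pi * t) : R[i]^o) (arc_subproof t).

Lemma continuous_expi : continuous (expi : R -> R[i]^o).
Proof.
move=> t.
apply/cvgrPdist_lt => -[e e'] /=; rewrite ltcE /= => /andP[/eqP -> e0].
have ct : cos x @[x --> t] --> cos t by exact: continuous_cos.
have st : sin x @[x --> t] --> sin t by exact: continuous_sin.
have e20 : 0 < e / 2 by rewrite divr_gt0.
move/cvgrPdist_lt: ct => /(_ _ e20) ct.
move/cvgrPdist_lt: st => /(_ _ e20) st.
near=> x.
have hc : `|cos t - cos x| < e / 2 by near: x.
have hs : `|sin t - sin x| < e / 2 by near: x.
rewrite -[e +i* 0]/(e%:C).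
have -> : (expi t - expi x : R[i]) = (cos t - cos x)%:C + (0 +i* (sin t - sin x)).
  by apply/eqP; rewrite eq_complex /= addr0 add0r !eqxx.
apply: (le_lt_trans (ler_normD _ _)).
rewrite !normc_def /= !expr0n /= addr0 add0r !sqrtr_sqr -rmorphD /= ltcR.
by rewrite (splitr e) ltrD.
Unshelve. all: by end_near. Qed.

Lemma continuous_arc : continuous arc.
Proof.
apply/continuousP => B [C oC <-]; rewrite -comp_preimage.
have -> : set_val \o arc = (fun t => expi (2 * pi * t) : R[i]^o) by [].
move: C oC; apply/continuousP => t.
apply: continuous_comp; last exact: continuous_expi.
exact: mulrl_continuous.
Qed.

Lemma measurable_arc : measurable_fun setT arc.
Proof.
apply: (measurability _ (erefl (measurable : set (set (circle R))))) => //.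
move=> _ [C oC <-]; rewrite setTI.
apply: open_measurable.
by move/continuousP: continuous_arc; apply.
Qed.

HB.instance Definition _ := isMeasurableFun.Build _ _ (measurableTypeR R) (circle R)
  (arc : measurableTypeR R -> circle R) measurable_arc.

(* Normalized arc length: the law of e^(2 i pi t) for t uniform on [0, 1]. *)
Definition circle_prob : probability (circle R) R :=
  distribution (uniform_prob (@ltr01 R)) (arc : {mfun measurableTypeR R >-> circle R}).

End circle.


Section torus.
Variables (R : realType) (I : Type).

Definition torus : Type := I -> circle R.

HB.instance Definition _ := Pointed.copy torus (I -> circle R).

(* The product sigma-algebra is generated by the coordinate maps. *)
Definition cylinders : set (set torus) :=
  \bigcup_(i in [set: I])
    preimage_set_system [set: torus] (fun z => z i) measurable.

HB.instance Definition _ :=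
  Measurable.copy torus (g_sigma_algebraType cylinders).

End torus.

(* A sequence (unif n)_n of independent uniform variables on [0, 1], used only
   to prove that the infinite product of circle_prob exists. The binary digits
   of t in even and odd positions make up two independent uniform variables
   (evens t) and (odds t); unif iterates this splitting. (digits n t) gives
   dyadic approximations from below of the pair (evens t, odds t). *)
Module UniformSequence.
Section coin.
Variable R : realType.
Local Notation mu := (@lebesgue_measure R).
Local Notation P := (uniform_prob (@ltr01 R)).
Implicit Types (A B : set (measurableTypeR R)) (x y t : R).

Lemma uniform01E A : measurable A -> P A = mu (A `&` `[0, 1[).
Proof.
move=> mA; rewrite /uniform_prob integral_uniform_pdf.
pose B : set (measurableTypeR R) := A `&` `[0, 1[.
pose C : set (measurableTypeR R) := A `&` [set 1].
have mB : measurable B by exact: measurableI.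
have mC : measurable C by exact: measurableI.
have C0 : mu C = 0%E.
  apply/eqP; rewrite eq_le measure_ge0 andbT -(lebesgue_measure_set1 (1 : R)).
  apply: le_measure; rewrite ?inE //; exact: subIsetr.
have -> : mu (A `&` `[0, 1[) = mu (B `|` C).
  apply/eqP; rewrite eq_le; apply/andP; split.
    by apply: le_measure; rewrite ?inE//; exact: measurableU.
  apply: (le_trans (measureU2 _ mB mC)).
  by move: C0; rewrite /= => ->; rewrite adde0.
have -> : B `|` C = A `&` `[0, 1] by rewrite -setIUr setUitv1 //= bnd_simp.
rewrite -[RHS]mul1e -integral_cst//; last exact: measurableI.
apply: eq_integral => t; rewrite inE /= in_itv /= => -[_ t01].
by rewrite /uniform_pdf t01 subr0 invr1.
Qed.

Lemma measurable_affine (b : R) :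
  measurable_fun setT (fun t : measurableTypeR R => 2 * t - b : measurableTypeR R).
Proof. by apply: measurable_funB => //; exact: measurable_funM. Qed.

Lemma lebesgue_affine (b : R) A : measurable A ->
  mu ((fun t => 2 * t - b) @^-1` A) = ((2^-1)%:E * mu A)%E.
Proof.
move=> mA.
pose h := fun t : measurableTypeR R => 2 * t - b : measurableTypeR R.
pose nu_ : {measure set (measurableTypeR R) -> \bar R} :=
  mscale (NngNum (ler0n R 2)) (pushforward mu h).
pose nu := nu_ (@measurable_affine b).
have nuE B : nu B = (2%:E * mu (h @^-1` B))%E by [].
have e : mu A = nu A.
  apply: lebesgue_measure_unique => // _ [[u v] _ <-].
  rewrite nuE.
  rewrite [X in (_ * lebesgue_measure X)%E](_ : _ = `](u + b) / 2, (v + b) / 2]%classic); last first.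
    apply/seteqP; split => t; rewrite /h /= !in_itv /= => /andP[? ?]; apply/andP; split; lra.
  rewrite !lebesgue_measure_itv /= !lte_fin.
  have -> : ((u + b) / 2 < (v + b) / 2) = (u < v).
    by apply/idP/idP => ?; lra.
  by case: ifP => _; rewrite ?mule0// -!EFinB -EFinM; congr EFin; lra.
by rewrite e nuE muleA -EFinM mulVf// mul1e.
Qed.

Definition bit t : R := if t < 2^-1 then 0 else 1.
Definition dbl t : R := 2 * t - bit t.

Lemma measurable_bit : measurable_fun setT (bit : measurableTypeR R -> measurableTypeR R).
Proof. by apply: measurable_fun_ifT => //; exact: measurable_fun_ltr. Qed.

Lemma measurable_dbl : measurable_fun setT (dbl : measurableTypeR R -> measurableTypeR R).
Proof.
apply: measurable_funB; last exact: measurable_bit.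
exact: measurable_funM.
Qed.

Lemma measurable_split A0 A1 : measurable A0 -> measurable A1 ->
  measurable [set t : measurableTypeR R | if t < 2^-1 then A0 (dbl t) else A1 (dbl t)].
Proof.
move=> m0 m1.
have -> : [set t : measurableTypeR R | if t < 2^-1 then A0 (dbl t) else A1 (dbl t)] =
   ([set t | t < 2^-1] `&` (dbl @^-1` A0)) `|` (~` [set t | t < 2^-1] `&` (dbl @^-1` A1)).
  apply/seteqP; split => t /=; case: ifPn => h //=.
  - by left.
  - by right; split => //; exact/negP.
  - by case=> -[].
  - by case=> -[] //; rewrite (negbTE h).
have mh : measurable [set t : measurableTypeR R | t < 2^-1].
  by rewrite (_ : [set _ | _] = `]-oo, 2^-1[%classic)// set_itvNyo.
apply: measurableU; apply: measurableI => //; last 2 first.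
- exact: measurableC.
- by rewrite -[X in measurable X]setTI; exact: measurable_dbl.
- by rewrite -[X in measurable X]setTI; exact: measurable_dbl.
Qed.

Lemma uniform_split A0 A1 : measurable A0 -> measurable A1 ->
  P [set t | if t < 2^-1 then A0 (dbl t) else A1 (dbl t)] =
  ((2^-1)%:E * P A0 + (2^-1)%:E * P A1)%E.
Proof.
move=> m0 m1.
rewrite !uniform01E//; last first.
  exact: measurable_split.
have m01 : measurable (`[0, 1[ : set R) by [].
rewrite -(lebesgue_affine 0); last exact: measurableI.
rewrite -(lebesgue_affine 1); last exact: measurableI.
rewrite -measureU//; first last.
- apply/seteqP; split => t //=; rewrite !in_itv/= => -[[_ h1] [_ h2]]; lra.
- by rewrite -[X in measurable X]setTI; apply: measurable_affine => //; exact: measurableI.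
- by rewrite -[X in measurable X]setTI; apply: measurable_affine => //; exact: measurableI.
congr (mu _); apply/seteqP; split => t /=; rewrite !in_itv/= /dbl /bit.
  by case: ltP => t2 -[At /andP[? ?]]; [left|right]; split => //;
    apply/andP; split; lra.
move=> [[At /andP[? ?]]|[At /andP[? ?]]].
  have -> : t < 2^-1 by lra.
  by split => //; apply/andP; split; lra.
have -> : (t < 2^-1) = false by apply/negbTE; rewrite -leNgt; lra.
by split => //; apply/andP; split; lra.
Qed.
Fixpoint digits n t : R * R :=
  if n is m.+1 then
    let p := digits m (dbl t) in ((bit t + p.2) / 2, p.1)
  else (0, 0).

Lemma digits_bounds n t :
  [/\ 0 <= (digits n t).1, (digits n t).1 <= 1, 0 <= (digits n t).2 & (digits n t).2 <= 1].
Proof.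
elim: n t => [|n IH] t /=; first by rewrite !lexx ler01.
have [h1 h2 h3 h4] := IH (dbl t).
by split => //; rewrite /bit; case: ifP => _; lra.
Qed.

Lemma digits_leS n t :
  (digits n t).1 <= (digits n.+1 t).1 /\ (digits n t).2 <= (digits n.+1 t).2.
Proof.
elim: n t => [|n IH] t.
  by have [? _ ? _] := digits_bounds 1 t.
have [h1 h2] := IH (dbl t); split; last exact: h1.
by rewrite [leLHS]/= [leRHS]/=; move: h2 => /=; lra.
Qed.

Lemma digits_le m n t : (m <= n)%N ->
  (digits m t).1 <= (digits n t).1 /\ (digits m t).2 <= (digits n t).2.
Proof.
elim: n => [|n IH]; first by rewrite leqn0 => /eqP ->.
rewrite leq_eqVlt => /predU1P[->//|/IH[h1 h2]].
by have [k1 k2] := digits_leS n t; split; [exact: le_trans h1 k1|exact: le_trans h2 k2].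
Qed.

Lemma measurable_digits n :
  measurable_fun setT (fun t : measurableTypeR R => (digits n t).1 : measurableTypeR R) /\
  measurable_fun setT (fun t : measurableTypeR R => (digits n t).2 : measurableTypeR R).
Proof.
elim: n => [|n [IH1 IH2]] /=; first by split; exact: measurable_cst.
split.
  apply: measurable_funM => //; apply: measurable_funD; first exact: measurable_bit.
  exact: (measurable_comp _ _ IH2 measurable_dbl).
exact: (measurable_comp _ _ IH1 measurable_dbl).
Qed.

Fixpoint tail n x : R :=
  if n is m.+1 then (tail m (2 * x) + tail m (2 * x - 1)) / 2 else (x < 0)%R%:R.

Definition orthant n x y := [set t : measurableTypeR R | x < (digits n t).1 /\ y < (digits n t).2].

Lemma measurable_gt_fun (f : measurableTypeR R -> measurableTypeR R) x :
  measurable_fun setT f -> measurable [set t | x < f t].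
Proof.
move=> mf; rewrite (_ : [set _ | _] = setT `&` f @^-1` `]x, +oo[%classic).
  exact: mf.
by rewrite setTI; apply/seteqP; split => t /=; rewrite in_itv/= andbT.
Qed.

Lemma measurable_orthant n x y : measurable (orthant n x y).
Proof.
have [m1 m2] := measurable_digits n.
by apply: measurableI; exact: measurable_gt_fun.
Qed.

Lemma prob_orthant n x y :
  P (orthant n x y) = (tail (uphalf n) x * tail n./2 y)%:E.
Proof.
elim: n x y => [|n IH] x y.
  rewrite /orthant /=; case: (ltP x 0) => hx; case: (ltP y 0) => hy /=.
  - by rewrite mulr1 (_ : [set _ | _] = setT) ?probability_setT// -subTset => t.
  - by rewrite mulr0 (_ : [set _ | _] = set0) ?measure0// -subset0 => t [].
  - by rewrite mul0r (_ : [set _ | _] = set0) ?measure0// -subset0 => t [].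
  - by rewrite mulr0 (_ : [set _ | _] = set0) ?measure0// -subset0 => t [].
have -> : orthant n.+1 x y =
  [set t | if t < 2^-1 then orthant n y (2 * x) (dbl t) else orthant n y (2 * x - 1) (dbl t)].
  apply/seteqP; split => t; rewrite /orthant /= {1}/bit; case: ifP => _ [h1 h2];
    split=> //; lra.
rewrite uniform_split; [|exact: measurable_orthant..].
rewrite !IH -!EFinM -EFinD; congr EFin => /=.
by rewrite uphalf_half; case: (odd n) => /=; lra.
Qed.

Definition utail x : R := if x < 0 then 1 else if x < 1 then 1 - x else 0.

Lemma utailE x : P `]x, +oo[ = (utail x)%:E.
Proof.
rewrite uniform01E//= /utail; case: ltP => x0.
  rewrite (_ : _ `&` _ = `[0, 1[%classic).
    by rewrite lebesgue_measure_itv/= lte_fin ltr01 -EFinB subr0.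
  apply/seteqP; split => t /=; rewrite !in_itv/= ?andbT; first by case.
  by move=> /andP[t0 t1]; rewrite t0 t1 (lt_le_trans x0 t0).
case: ltP => x1.
  rewrite (_ : _ `&` _ = `]x, 1[%classic).
    by rewrite lebesgue_measure_itv/= lte_fin x1.
  apply/seteqP; split => t /=; rewrite !in_itv/= ?andbT.
    by case=> -> /andP[].
  by move=> /andP[xt t1]; rewrite xt t1 (le_trans x0 (ltW xt)).
rewrite (_ : _ `&` _ = set0) ?measure0// -subset0 => t /=.
rewrite !in_itv/= ?andbT => -[xt /andP[_ t1]].
by have := lt_trans (le_lt_trans x1 xt) t1; rewrite ltxx.
Qed.

Lemma tail_out n x : x < 0 \/ 1 <= x -> tail n x = utail x.
Proof.
elim: n x => [|n IH] x h.
  by rewrite /utail /=; case: ltP h => //= x0 [//|x1]; case: ltP => //; lra.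
rewrite /= !IH; last first.
- by case: h => h; [left|right]; lra.
- by case: h => h; [left|right]; lra.
case: h => h; rewrite /utail.
  have -> : 2 * x < 0 by lra.
  have -> : 2 * x - 1 < 0 by lra.
  by rewrite h; lra.
have -> : (2 * x < 0) = false by apply/negbTE; rewrite -leNgt; lra.
have -> : (2 * x < 1) = false by apply/negbTE; rewrite -leNgt; lra.
have -> : (2 * x - 1 < 0) = false by apply/negbTE; rewrite -leNgt; lra.
have -> : (2 * x - 1 < 1) = false by apply/negbTE; rewrite -leNgt; lra.
have -> : (x < 0) = false by apply/negbTE; rewrite -leNgt; lra.
have -> : (x < 1) = false by apply/negbTE; rewrite -leNgt; lra.
by lra.
Qed.

Lemma tail_utail n x : `|tail n x - utail x| <= 2^-1 ^+ n.
Proof.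
elim: n x => [|n IH] x.
  rewrite expr0 /utail /=; case: ltP => x0 /=; first by rewrite subrr normr0.
  by case: ltP => x1; rewrite ler_norml; apply/andP; split; lra.
have e : utail x = (utail (2 * x) + utail (2 * x - 1)) / 2.
  by rewrite /utail; case: (ltP x 0) => h1; case: (ltP x 1) => h2;
    case: (ltP (2 * x) 0) => h3; case: (ltP (2 * x) 1) => h4;
    case: (ltP (2 * x - 1) 0) => h5; case: (ltP (2 * x - 1) 1) => h6; lra.
rewrite e exprS /=.
have lin (a b c f d : R) : a = b -> `|c - f| <= d ->
    `|(c + a) / 2 - (f + b) / 2| <= 2^-1 * d.
  rewrite !ler_norml => ab /andP[a3 a4].
  by apply/andP; split; lra.
have [x1|x1] := ltP (2 * x - 1) 0; first exact: lin (tail_out n (or_introl x1)) (IH _).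
rewrite [tail n _ + _]addrC [utail _ + _]addrC.
apply: lin (IH _); apply: tail_out; right; lra.
Qed.

Lemma cvg_tail x : tail n x @[n --> \oo] --> utail x.
Proof.
apply/cvgrPdist_le => e e0.
have : (2^-1 : R) ^+ n @[n --> \oo] --> (0 : R).
  by apply: cvg_expr; rewrite ger0_norm ?invr_ge0//; lra.
move=> /cvgrPdist_le /(_ _ e0); apply: filterS => n.
rewrite sub0r normrN ger0_norm ?exprn_ge0 ?invr_ge0//.
by apply: le_trans; rewrite distrC tail_utail.
Qed.

Definition evens t : R := sup (range (fun n => (digits n t).1)).
Definition odds t : R := sup (range (fun n => (digits n t).2)).

Lemma has_sup_digits1 t : has_sup (range (fun n => (digits n t).1)).
Proof.
split; first by exists 0; exists 0%N.
by exists 1 => _ [n _ <-]; have [] := digits_bounds n t.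
Qed.

Lemma has_sup_digits2 t : has_sup (range (fun n => (digits n t).2)).
Proof.
split; first by exists 0; exists 0%N.
by exists 1 => _ [n _ <-]; have [] := digits_bounds n t.
Qed.

Lemma gt_evens x t : x < evens t <-> exists n, x < (digits n t).1.
Proof.
split.
  by move=> /(sup_gt (has_sup_digits1 t).1)[_ [n _ <-]]; exists n.
move=> [n /lt_le_trans]; apply; apply: sup_upper_bound; first exact: has_sup_digits1.
by exists n.
Qed.

Lemma gt_odds x t : x < odds t <-> exists n, x < (digits n t).2.
Proof.
split.
  by move=> /(sup_gt (has_sup_digits2 t).1)[_ [n _ <-]]; exists n.
move=> [n /lt_le_trans]; apply; apply: sup_upper_bound; first exact: has_sup_digits2.
by exists n.
Qed.

Lemma measurable_evens : measurable_fun setT (evens : measurableTypeR R -> measurableTypeR R).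
Proof.
apply: (measurability _ (RGenOInfty.measurableE R)) => // _ [_ [x ->] <-].
rewrite setTI (_ : _ @^-1` _ = \bigcup_n [set t | x < (digits n t).1]).
  apply: bigcup_measurable => n _.
  by apply: measurable_gt_fun; have [] := measurable_digits n.
apply/seteqP; split => t /=; rewrite in_itv/= andbT.
  by move=> /gt_evens[n]; exists n.
by move=> [n _ h]; apply/gt_evens; exists n.
Qed.

Lemma measurable_odds : measurable_fun setT (odds : measurableTypeR R -> measurableTypeR R).
Proof.
apply: (measurability _ (RGenOInfty.measurableE R)) => // _ [_ [x ->] <-].
rewrite setTI (_ : _ @^-1` _ = \bigcup_n [set t | x < (digits n t).2]).
  apply: bigcup_measurable => n _.
  by apply: measurable_gt_fun; have [] := measurable_digits n.
apply/seteqP; split => t /=; rewrite in_itv/= andbT.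
  by move=> /gt_odds[n]; exists n.
by move=> [n _ h]; apply/gt_odds; exists n.
Qed.

Lemma prob_ray_ray x y :
  P (evens @^-1` `]x, +oo[ `&` odds @^-1` `]y, +oo[) = (P `]x, +oo[ * P `]y, +oo[)%E.
Proof.
have -> : evens @^-1` `]x, +oo[ `&` odds @^-1` `]y, +oo[ = \bigcup_n orthant n.*2 x y.
  apply/seteqP; split => t /=; rewrite !in_itv/= !andbT.
    move=> [/gt_evens[n hn] /gt_odds[m hm]]; exists (maxn n m) => //.
    have nN : (n <= (maxn n m).*2)%N by rewrite -addnn (leq_trans (leq_maxl n m)) ?leq_addr.
    have mN : (m <= (maxn n m).*2)%N by rewrite -addnn (leq_trans (leq_maxr n m)) ?leq_addr.
    by split; [exact: lt_le_trans hn (digits_le t nN).1|exact: lt_le_trans hm (digits_le t mN).2].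
  by move=> [n _ [h1 h2]]; split; [apply/gt_evens|apply/gt_odds]; eexists; eassumption.
have h1 : P (orthant n.*2 x y) @[n --> \oo] --> P (\bigcup_n orthant n.*2 x y).
  apply: nondecreasing_cvg_mu.
  - by move=> n; exact: measurable_orthant.
  - by apply: bigcup_measurable => n _; exact: measurable_orthant.
  - move=> n m nm; apply/subsetPset => t [k1 k2].
    have nm2 : (n.*2 <= m.*2)%N by rewrite leq_double.
    by split; [exact: lt_le_trans k1 (digits_le t nm2).1|exact: lt_le_trans k2 (digits_le t nm2).2].
have h2 : P (orthant n.*2 x y) @[n --> \oo] --> (utail x * utail y)%:E.
  under eq_fun do rewrite prob_orthant uphalf_double doubleK.
  apply: cvg_EFin; first exact: nearW.
  by apply: cvgM; exact: cvg_tail.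
by rewrite !utailE -EFinM; apply: (cvg_unique _ h1 h2).
Qed.

Lemma rays_unique (m1 m2 : {measure set (measurableTypeR R) -> \bar R}) :
  (forall x, m1 `]x, +oo[%classic = m2 `]x, +oo[%classic) ->
  (forall x, (m1 `]x, +oo[%classic < +oo)%E) ->
  forall A, measurable A -> m1 A = m2 A.
Proof.
move=> m12 m1oo A mA.
apply: (@measure_unique _ R (measurableTypeR R) (@RGenOInfty.G R) (fun n => `](- n%:R), +oo[%classic)) => //.
- exact: RGenOInfty.measurableE.
- move=> _ _ [x ->] [y ->]; exists (Num.max x y).
  by apply/seteqP; split => t /=; rewrite !in_itv/= !andbT gt_max => /andP.
- by move=> n; eexists.
- rewrite -subTset => t _; exists (Num.trunc `|t|).+1 => //=; rewrite in_itv/= andbT.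
  rewrite ltrNl; apply: le_lt_trans (truncnS_gt _).
  by rewrite -normrN ler_norm.
- by move=> _ [x ->].
Qed.

Lemma rays_preimage (f : measurableTypeR R -> measurableTypeR R) (D : set (measurableTypeR R)) (c : {nonneg R}) :
  measurable_fun setT f -> measurable D ->
  (forall x, P (f @^-1` `]x, +oo[ `&` D) = (c%:num%:E * P `]x, +oo[)%E) ->
  forall A, measurable A -> P (f @^-1` A `&` D) = (c%:num%:E * P A)%E.
Proof.
move=> mf mD h A mA.
pose m1_ : {measure set (measurableTypeR R) -> \bar R} := pushforward (mrestr P mD) f.
pose m1 := m1_ mf.
pose m2 : {measure set (measurableTypeR R) -> \bar R} := mscale c P.
have m1E B : m1 B = P (f @^-1` B `&` D) by [].
have m2E B : m2 B = (c%:num%:E * P B)%E by [].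
apply: (@rays_unique m1 m2) => // x.
apply: (@le_lt_trans _ _ 1%E); last exact: ltry.
rewrite m1E; apply: probability_le1; apply: measurableI => //.
by rewrite -[X in measurable X]setTI; apply: (mf measurableT).
Qed.

Lemma prob_evens_odds A B : measurable A -> measurable B ->
  P (evens @^-1` A `&` odds @^-1` B) = (P A * P B)%E.
Proof.
move=> mA mB.
have mpre (f : measurableTypeR R -> measurableTypeR R) C : measurable_fun setT f -> measurable C ->
    measurable (f @^-1` C).
  by move=> mf mC; rewrite -[X in measurable X]setTI; apply: mf.
have fP C : measurable C -> exists c : {nonneg R}, c%:num%:E = P C.
  move=> mC; have fC : P C \is a fin_num by exact: fin_num_measure.
  have c0 : 0 <= fine (P C) by exact/fine_ge0/measure_ge0.
  by exists (NngNum c0); rewrite /= fineK.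
have h y : P (evens @^-1` A `&` odds @^-1` `]y, +oo[) = (P A * P `]y, +oo[)%E.
  have [c cE] := fP `]y, +oo[%classic (measurable_itv _).
  rewrite -cE muleC; apply: rays_preimage => //; first exact: measurable_evens.
    by apply: mpre => //; exact: measurable_odds.
  by move=> x; rewrite cE muleC prob_ray_ray.
have [c cE] := fP A mA.
rewrite -cE setIC; apply: rays_preimage => //; first exact: measurable_odds.
  by apply: mpre => //; exact: measurable_evens.
by move=> y; rewrite cE setIC h.
Qed.

Fixpoint unif n t : R := if n is m.+1 then unif m (odds t) else evens t.

Lemma measurable_unif n : measurable_fun setT (unif n : measurableTypeR R -> measurableTypeR R).
Proof.
elim: n => [|n IH] /=; first exact: measurable_evens.
exact: (measurable_comp _ _ IH measurable_odds).
Qed.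

Lemma unif_indep n (B : nat -> set (measurableTypeR R)) : (forall i, measurable (B i)) ->
  P [set t | forall i, (i < n)%N -> B i (unif i t)] = (\prod_(i < n) P (B i))%E.
Proof.
elim: n B => [|n IH] B mB.
  by rewrite big_ord0 (_ : [set _ | _] = setT) ?probability_setT// -subTset => t _ i.
rewrite big_ord_recl /= -(IH (fun i => B i.+1))//.
rewrite -prob_evens_odds//; last first.
  rewrite (_ : [set _ | _] = \bigcap_(i in [set i | (i < n)%N]) (unif i @^-1` (B i.+1))) //.
  apply: bigcap_measurableType => i _; rewrite -[X in measurable X]setTI.
  exact: measurable_unif.
congr (P _); apply/seteqP; split => t /=.
  by move=> h; split; [exact: (h 0%N)|move=> i ni; exact: (h i.+1)].
by move=> [h0 h] [|i] //; exact: h.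
Qed.

End coin.
End UniformSequence.

(* A law on torus R I is the product of copies of circle_prob when it has the
   product value on every measurable rectangle with finitely many constraints;
   these rectangles form a pi-system generating the product sigma-algebra, so
   there is at most one such law. *)
Definition is_product_prob (R : realType) (I : choiceType)
    (Q : probability (torus R I) R) : Prop :=
  forall (J : {fset I}) (A : I -> set (circle R)),
    (forall i, measurable (A i)) ->
    Q [set z | forall i, i \in J -> A i (z i)] =
    (\prod_(i <- J) circle_prob R (A i))%E.

Section existence.
Variables (R : realType) (I : countType).
Local Notation P := (uniform_prob (@ltr01 R)).

Definition unif_torus (t : measurableTypeR R) : torus R I :=
  fun i => arc (UniformSequence.unif (choice.pickle i) t).

Lemma measurable_unif_torus : measurable_fun setT unif_torus.
Proof.
apply: (measurability _ (erefl (measurable : set (set (torus R I))))) => //.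
move=> _ [_ [i _ [A mA <-]] <-]; rewrite !setTI.
rewrite -[X in measurable X]setTI.
by apply: (measurable_comp measurableT _ (@measurable_arc R)
  (@UniformSequence.measurable_unif R (choice.pickle i))).
Qed.

HB.instance Definition _ :=
  isMeasurableFun.Build _ _ (measurableTypeR R) (torus R I) unif_torus
    measurable_unif_torus.

Lemma ex_torus_prob : exists Q : probability (torus R I) R, is_product_prob Q.
Proof.
exists (distribution P (unif_torus : {mfun measurableTypeR R >-> torus R I})).
move=> J A mA; rewrite /distribution /pushforward /=.
pose B n : set (measurableTypeR R) :=
  if pickle_inv n is Some i then
    if i \in J then (fun t : measurableTypeR R => arc t) @^-1` A i else setT
  else setT.
have mB n : measurable (B n).
  rewrite /B; case: pickle_inv => [i|] //; case: ifP => // _.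
  by rewrite -[X in measurable X]setTI; apply: measurable_arc.
have BE i : i \in J -> B (choice.pickle i) = arc (R := R) @^-1` A i.
  by rewrite /B pickleK_inv => ->.
pose N := (\max_(i <- J) choice.pickle i).+1.
have ltN i : i \in J -> (choice.pickle i < N)%N by move=> iJ; rewrite ltnS leq_bigmax_seq.
have -> : unif_torus @^-1` [set z | forall i, i \in J -> A i (z i)] =
    [set t | forall n, (n < N)%N -> B n (UniformSequence.unif n t)].
  apply/seteqP; split => t /= h; last first.
    by move=> i iJ; have := h _ (ltN _ iJ); rewrite BE.
  move=> n _; rewrite /B; case e : pickle_inv => [i|] //; case: ifP => // iJ.
  have <- : choice.pickle i = n by have := @pickle_invK I n; rewrite e.
  exact: h.
rewrite UniformSequence.unif_indep//.
rewrite -(big_mkord xpredT (fun n => P (B n))).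
rewrite (bigID (mem [seq choice.pickle i | i <- J])) /= [X in (_ * X)%E]big1 ?mule1; last first.
  move=> n nJ; rewrite /B; case e : pickle_inv => [i|]; last exact: probability_setT.
  case: ifP => iJ; last exact: probability_setT.
  case/negP: nJ; apply/mapP; exists i => //.
  by have := @pickle_invK I n; rewrite e.
rewrite -big_filter.
rewrite (perm_big [seq choice.pickle i | i <- J]); last first.
  apply: uniq_perm; first by rewrite filter_uniq ?iota_uniq.
    by rewrite map_inj_uniq ?fset_uniq//; exact: (pcan_inj choice.pickleK).
  move=> n; rewrite mem_filter mem_index_iota /=.
  case: (boolP (n \in _)) => // /mapP[i iJ ->] /=.
  exact: ltN.
rewrite big_map; apply: eq_big_seq => i iJ.
by rewrite BE.
Qed.

Definition torus_prob : probability (torus R I) R := projT1 (cid ex_torus_prob).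

Lemma torus_probP : is_product_prob torus_prob.
Proof. exact: projT2 (cid ex_torus_prob). Qed.

End existence.

(* A multi-index over a countable index type I is a finitely supported map
   I -> nat: N_0^N for I = 'I_N, and N_0^(N) for I = nat. *)
Definition degree (I : choiceType) (a : {fsfun I -> nat with 0%N}) : nat :=
  (\sum_(i <- finsupp a) a i)%N.

Section cotype.
Variables (R : realType) (X : completeNormedModType R[i]).

(* The norm of X takes its values in R[i], where it is a nonnegative real. *)
Definition rnorm (v : X) : R := complex.Re `|v|.

Definition bnorm d (T : measurableType d) (mu : probability T R) (p : R)
    (f : T -> X) : \bar R :=
  ((\int[mu]_z ((rnorm (f z)) `^ p)%:E) `^ p^-1)%E.

Definition monomial (I : choiceType) (a : {fsfun I -> nat with 0%N})
    (z : torus R I) : R[i] :=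
  \prod_(i <- finsupp a) cval (z i) ^+ a i.

Definition conj_exponent (q : R) : R := (1 - q^-1)^-1.

Definition fourier_cotype (q : R) : Prop :=
  exists2 C : R, 0 < C & forall (N : nat) (x : nat -> X),
    (((\sum_(1 <= k < N.+1) rnorm (x k) `^ q) `^ q^-1)%:E <=
     C%:E * bnorm (circle_prob R) (conj_exponent q)
       (fun z => \sum_(1 <= k < N.+1) cval z ^+ k *: x k)%R)%E.

Definition hypercontractive_homogeneous_cotype (q : R) : Prop :=
  exists2 C : R, 0 < C & forall (m : nat)
      (x : {fsfun {fsfun nat -> nat with 0%N} -> X with 0}), (0 < m)%N ->
    (((\sum_(a <- finsupp x | degree a == m) rnorm (x a) `^ q) `^ q^-1)%:E <=
     (C ^+ m)%:E * bnorm (torus_prob R nat) 2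
       (fun z => \sum_(a <- finsupp x | degree a == m) monomial a z *: x a)%R)%E.

End cotype.

(* Main.v *)
(** The exponents of finitely many multi-indices, each with entries below d, are
separated by the Kronecker weight k(a) = sum_i a_i d^i. For fixed z in the
torus, Fourier cotype applied to the vectors z^a x_a placed at the frequencies
k(a) bounds sum_a |x_a|^q by an integral over w in T of the polynomial at the
rotated point (w^(d^i) z_i)_i. Integrating over z as well, Tonelli and the
rotation invariance of Haar measure remove w, with the same constant C and in
any (even infinite) number of variables. For m-homogeneous polynomials
C <= max(C, 1)^m, and the L^q' norm is at most the L^2 norm since q' <= 2. *)

From HB Require Import structures.
From Pilot Require Import Defs.
From mathcomp Require Import all_boot all_order all_algebra.
From mathcomp Require Import finmap complex.
From mathcomp Require Import all_classical all_reals all_analysis.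
From mathcomp Require Import measurable_realfun ring lra.

Import Order.TTheory GRing.Theory Num.Theory.
Import numFieldNormedType.Exports.
Local Open Scope classical_set_scope.
Local Open Scope ring_scope.

(** * Rotation invariance *)

(** The push-forward under the translation gives each []u, v]] its length, and these intervals
    determine Lebesgue measure. *)
Lemma lebesgue_measure_translate {R : realType} (s : R) (A : set R) :
  measurable A ->
  lebesgue_measure ((fun t => t + s) @^-1` A) = lebesgue_measure A.
Proof.
move=> mA.
have ms : measurable_fun setT
    (fun t : measurableTypeR R => t + s : measurableTypeR R).
  exact: measurable_funD.
pose nu_ : {measure set (measurableTypeR R) -> \bar R} :=
  pushforward (@lebesgue_measure R) (fun t : measurableTypeR R => t + s : measurableTypeR R).
pose nu := nu_ ms.
have nuE B : nu B = lebesgue_measure ((fun t : measurableTypeR R => t + s) @^-1` B).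
  by [].
rewrite -[LHS]nuE; apply/esym.
apply: lebesgue_measure_unique => // _ [[u v] _ <-].
rewrite [RHS]nuE.
have -> : (fun t : measurableTypeR R => t + s) @^-1` `]u, v]%classic =
    `]u - s, v - s]%classic.
  apply/seteqP; split => t /=; rewrite !in_itv /= => /andP[? ?];
    by apply/andP; split; lra.
rewrite !lebesgue_measure_itv /= !lte_fin ltrD2r.
by case: ifP => // _; congr EFin; lra.
Qed.

(** Translation modulo 1 exchanges two pieces of [[0, 1[]; on each piece it is an ordinary
    translation, which preserves Lebesgue measure. *)
Lemma uniform_prob_periodic {R : realType} (s : R) (B : set (measurableTypeR R)) :
  measurable B -> (forall t, B (t + 1) <-> B t) ->
  uniform_prob (@ltr01 R) ((fun t => t + s) @^-1` B) =
  uniform_prob (@ltr01 R) B.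
Proof.
move=> mB pB.
have msh r (A : set (measurableTypeR R)) : measurable A ->
    measurable ((fun t : measurableTypeR R => t + r : measurableTypeR R) @^-1` A).
  by move=> mA; rewrite -[X in measurable X]setTI; apply: measurable_funD.
have pBn (n : nat) t : B (t + n%:R) <-> B t.
  elim: n => [|n IH]; first by rewrite addr0.
  by rewrite -natr1 addrA pB.
have pBz (m : int) t : B (t + m%:~R) <-> B t.
  case: m => n; first exact: pBn.
  rewrite -(pBn n.+1) NegzE mulrNz subrK; exact: iff_refl.
(* Integer translations preserve [B], so only the fractional part of [s] matters. *)
pose r := s - (Num.floor s)%:~R.
have r0 : 0 <= r by rewrite subr_ge0 floor_le_tmp.
have r1 : r < 1 by rewrite ltrBlDl -[X in _ + X]/(1%:~R) -intrD1 floorD1_gt.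
have -> : (fun t => t + s) @^-1` B = (fun t => t + r) @^-1` B.
  apply/seteqP; split => t /=; rewrite /r addrA -mulrNz pBz //.
pose C1 := B `&` `[r, 1[%classic; pose C2 := B `&` `[0, r[%classic.
have mC1 : measurable C1 by exact: measurableI.
have mC2 : measurable C2 by exact: measurableI.
rewrite !UniformSequence.uniform01E//; last exact: msh.
have -> : B `&` `[0, 1[%classic = C1 `|` C2.
  rewrite /C1 /C2; apply/seteqP; split => t /=; rewrite !in_itv /=.
    move=> [Bt /andP[? ?]]; case: (leP r t) => rt; [left|right]; split=> //;
      by apply/andP; split; lra.
  by case=> -[Bt /andP[? ?]]; split=> //; apply/andP; split; lra.
(* Points [t + r] below 1 fall in [C1]; the others wrap around and fall in [C2] after subtracting
   1. *)
have -> : ((fun t => t + r) @^-1` B) `&` `[0, 1[%classic =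
    ((fun t : measurableTypeR R => t + r : measurableTypeR R) @^-1` C1) `|`
    ((fun t => t + (r - 1)) @^-1` C2).
  rewrite /C1 /C2; apply/seteqP; split => t /=; rewrite !in_itv /=.
    move=> [Bt /andP[? ?]]; case: (ltP (t + r) 1) => rt; [left|right]; split=> //.
    - by apply/andP; split; lra.
    - by rewrite -pB (_ : _ + _ + 1 = t + r) //; ring.
    - by apply/andP; split; lra.
  case=> -[Bt /andP[? ?]]; split=> //; try (by apply/andP; split; lra).
  by move: Bt; rewrite -pB (_ : _ + _ + 1 = t + r) //; ring.
rewrite !measureU//; first last.
- rewrite /C1 /C2; apply/seteqP; split => t //=; rewrite !in_itv /=.
  by move=> [[_ /andP[? ?]] [_ /andP[? ?]]]; lra.
- exact: msh.
- exact: msh.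
- rewrite /C1 /C2; apply/seteqP; split => t //=; rewrite !in_itv /=.
  by move=> [[_ /andP[? ?]] [_ /andP[? ?]]]; lra.
by congr (_ + _)%E; exact: lebesgue_measure_translate.
Qed.

(** * Rotations of the circle and its coordinate functions *)

Lemma norm_cval {R : realType} (z : circle R) : `|cval z| = 1.
Proof. by have := valP z; rewrite inE. Qed.

Lemma cmul_subproof {R : realType} (w z : circle R) :
  (cval w * cval z : R[i]^o) \in @unit_circle R.
Proof.
by rewrite inE /unit_circle /= normrM !norm_cval mulr1.
Qed.

Definition cmul {R : realType} (w z : circle R) : circle R :=
  exist _ (cval w * cval z : R[i]^o) (cmul_subproof w z).

Lemma arcD {R : realType} (s t : R) : Defs.arc (t + s) = cmul (Defs.arc s) (Defs.arc t).
Proof.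
apply: val_inj; rewrite /= /expi mulrDr cosD sinD.
by apply/eqP; rewrite eq_complex /=; apply/andP; split; apply/eqP; ring.
Qed.

Lemma arcD1 {R : realType} (t : R) : Defs.arc (t + 1) = Defs.arc t.
Proof.
apply: val_inj.
have e : 2 * pi * (t + 1) = 2 * pi * t + pi *+ 2 by rewrite mulr2n; ring.
by rewrite /= /expi e cosD2pi sinD2pi.
Qed.

Lemma continuous_cval {R : realType} : continuous (fun z : circle R => cval z : R[i]^o).
Proof. exact: initial_continuous. Qed.

Lemma continuous_cmul {R : realType} (w : circle R) : continuous (cmul w).
Proof.
apply/continuousP => _ [C oC <-]; rewrite -comp_preimage.
have -> : set_val \o cmul w = (fun z : circle R => cval w * cval z : R[i]^o) by [].
move: C oC; apply/continuousP => z.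
exact: (cvgM (cvg_cst (cval w : R[i]^o)) (continuous_cval z)).
Qed.

Lemma measurable_cmul {R : realType} (w : circle R) :
  measurable_fun setT (cmul w).
Proof.
apply: (measurability _ (erefl (measurable : set (set (circle R))))) => //.
move=> _ [B oB <-]; rewrite setTI; apply: sub_sigma_algebra.
by move/continuousP: (@continuous_cmul _ w); apply.
Qed.

(** The pull-back of [A] along [arc] is 1-periodic, and by [arcD] the rotation by [arc s] acts on it
    as translation by [s]. *)
Lemma circle_prob_cmul {R : realType} (s : R) (A : set (circle R)) :
  measurable A -> circle_prob R (cmul (Defs.arc s) @^-1` A) = circle_prob R A.
Proof.
move=> mA; rewrite /circle_prob /distribution /pushforward /=.
rewrite -(@uniform_prob_periodic _ s (fun t => A (Defs.arc t))).
- by congr (uniform_prob _ _); apply/seteqP; split => t /=; rewrite arcD.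
- rewrite -[X in measurable X]setTI.
  exact: (@measurable_arc R).
- by move=> t; rewrite arcD1.
Qed.

Lemma measurable_continuous_circle {R : realType} (f : circle R -> R) :
  continuous f -> measurable_fun setT (f : circle R -> measurableTypeR R).
Proof.
move=> cf; apply: (measurability _ (RGenOInfty.measurableE R)) => //.
move=> _ [_ [x ->] <-]; rewrite setTI; apply: sub_sigma_algebra.
by move/continuousP: cf; apply; exact: interval_open.
Qed.

Lemma continuous_Re {R : realType} : continuous (@complex.Re R : R[i]^o -> R).
Proof.
move=> z.
have F : ProperFilter (nbhs (z : R[i]^o)) by exact: nbhs_pfilter.
apply/cvgrPdist_lt => e e0.
near=> w.
have h : `|z - w| < (e%:C)%C.
  by near: w; apply: (@nbhsx_ballx _ R[i]^o z (e%:C)%C); rewrite ltcR.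
rewrite -ltcR; apply: le_lt_trans h.
by rewrite -raddfB /=; exact: normc_ge_Re.
Unshelve. all: by end_near. Qed.

Lemma continuous_Im {R : realType} : continuous (@complex.Im R : R[i]^o -> R).
Proof.
move=> z.
have F : ProperFilter (nbhs (z : R[i]^o)) by exact: nbhs_pfilter.
apply/cvgrPdist_lt => e e0.
near=> w.
have h : `|z - w| < (e%:C)%C.
  by near: w; apply: (@nbhsx_ballx _ R[i]^o z (e%:C)%C); rewrite ltcR.
rewrite -ltcR; apply: le_lt_trans h.
rewrite -raddfB /= normc_def lecR -sqrtr_sqr.
by apply: ler_wsqrtr; rewrite lerDr sqr_ge0.
Unshelve. all: by end_near. Qed.

Lemma measurable_Re_cval {R : realType} :
  measurable_fun setT (fun z : circle R => complex.Re (cval z) : measurableTypeR R).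
Proof.
apply: measurable_continuous_circle => z.
exact: (continuous_comp (continuous_cval z) (continuous_Re _)).
Qed.

Lemma measurable_Im_cval {R : realType} :
  measurable_fun setT (fun z : circle R => complex.Im (cval z) : measurableTypeR R).
Proof.
apply: measurable_continuous_circle => z.
exact: (continuous_comp (continuous_cval z) (continuous_Im _)).
Qed.

(** * Uniqueness of the product law and rotations of the torus *)

Section torus_rotation.
Context {R : realType} {I : choiceType}.

Lemma measurable_coord (i : I) : measurable_fun setT (fun z : torus R I => z i).
Proof.
move=> _ B mB; rewrite setTI; apply: sub_sigma_algebra.
by exists i => //; exists B => //; rewrite setTI.
Qed.

Definition box (J : {fset I}) (A : I -> set (circle R)) : set (torus R I) :=
  [set z | forall i, i \in J -> A i (z i)].

Lemma measurable_box (J : {fset I}) (A : I -> set (circle R)) :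
  (forall i, measurable (A i)) -> measurable (box J A).
Proof.
move=> mA.
rewrite (_ : box J A = \bigcap_(i in [set` J]) ((fun z => z i) @^-1` A i)) //.
apply: fin_bigcap_measurable => // i _.
by rewrite -[X in measurable X]setTI; exact: measurable_coord.
Qed.

(** Boxes form a pi-system, generate the product sigma-algebra since one-coordinate cylinders are
    boxes, and receive the same finite value from both laws. *)
Lemma is_product_prob_unique (Q1 Q2 : probability (torus R I) R) :
  is_product_prob Q1 -> is_product_prob Q2 ->
  forall A, measurable A -> Q1 A = Q2 A.
Proof.
move=> p1 p2.
pose G : set (set (torus R I)) :=
  [set E | exists J A, (forall i, measurable (A i)) /\ E = box J A].
have GT : G setT.
  exists fset0, (fun=> setT); split; first by move=> i; exact: measurableT.
  by apply/seteqP; split => z.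
have mG : measurable = <<s G >>.
  apply/seteqP; split.
    apply: smallest_sub; first exact: smallest_sigma_algebra.
    move=> _ [i _ [A mA <-]]; apply: sub_sigma_algebra.
    exists [fset i]%fset, (fun=> A); split => //.
    rewrite setTI; apply/seteqP; split => z /=.
      by move=> Az j /[!inE] /eqP ->.
    by apply; rewrite inE.
  apply: smallest_sub; first exact: smallest_sigma_algebra.
  by move=> _ [J [A [mA ->]]]; exact: measurable_box.
apply: (measure_unique G (fun=> setT)) => //.
- move=> _ _ [J [A [mA ->]]] [K [B [mB ->]]].
  (* On coordinates outside its own index set each box is unconstrained, hence [setT]. *)
  exists (J `|` K)%fset, (fun i => (if i \in J then A i else setT) `&`
                        (if i \in K then B i else setT)); split.
    by move=> i; apply: measurableI; case: ifP.
  apply/seteqP; split => z /=.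
    move=> [hA hB] i _; split; case: ifP => // h; [exact: hA|exact: hB].
  move=> h; split=> i ij; have := h i; rewrite inE ij ?orbT => /(_ isT) [].
  - by [].
  - by move=> _.
- by rewrite bigcup_const.
- by move=> _ [J [A [mA ->]]]; exact: (etrans (p1 J A mA) (esym (p2 J A mA))).
- move=> _; apply: (@le_lt_trans _ _ 1%E); last exact: ltry.
  exact: probability_le1.
Qed.

Definition torus_mul (w z : torus R I) : torus R I := fun i => cmul (w i) (z i).

Lemma measurable_torus_mul (w : torus R I) : measurable_fun setT (torus_mul w).
Proof.
apply: (measurability _ (erefl (measurable : set (set (torus R I))))) => //.
move=> _ [_ [i _ [A mA <-]] <-]; rewrite !setTI.
rewrite -[X in measurable X]setTI.
exact: (measurable_comp measurableT _ (@measurable_cmul R (w i))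
  (measurable_coord i)).
Qed.

End torus_rotation.

(** The image of [torus_prob] under the rotation is again a product law, coordinate by coordinate,
    so uniqueness identifies it with [torus_prob]; the rest is change of variables. *)
Lemma ge0_integral_torus_mul {R : realType} {I : countType} (s : I -> R)
    (f : torus R I -> \bar R) :
  measurable_fun setT f -> (forall z, 0 <= f z)%E ->
  (\int[torus_prob R I]_z f (torus_mul (fun i => Defs.arc (s i)) z) =
   \int[torus_prob R I]_z f z)%E.
Proof.
move=> mf f0.
pose r : {mfun torus R I >-> torus R I} :=
  HB.pack (torus_mul (fun i => Defs.arc (s i)))
   (isMeasurableFun.Build _ _ _ _ _ (measurable_torus_mul (fun i => Defs.arc (s i)))).
have pr : is_product_prob (distribution (torus_prob R I) r).
  move=> J A mA.
  have mA' i : measurable (cmul (Defs.arc (s i)) @^-1` A i).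
    by rewrite -[X in measurable X]setTI; exact: measurable_cmul.
  apply: etrans (torus_probP J mA') _.
  by apply: eq_bigr => i _; exact: circle_prob_cmul.
rewrite -[LHS](ge0_integral_distribution r mf f0).
apply: eq_measure_integral => A mA _.
by apply: is_product_prob_unique => //; exact: torus_probP.
Qed.

(** * Measurability of norms of vector-valued sums *)

Section rnorm.
Context {R : realType} {X : completeNormedModType R[i]}.
Implicit Types (u v : X) (c : R[i]).

Lemma rnormE v : `|v| = ((rnorm v)%:C)%C.
Proof. by rewrite /rnorm RRe_real// normr_real. Qed.

Lemma rnorm_ge0 v : 0 <= rnorm v.
Proof. by rewrite -lecR -rnormE; exact: normr_ge0. Qed.

Lemma ler_rnormD u v : rnorm (u + v) <= rnorm u + rnorm v.
Proof. by rewrite -lecR rmorphD /= -!rnormE ler_normD. Qed.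

Lemma rnormZ c v : rnorm (c *: v) = complex.Re `|c| * rnorm v.
Proof.
apply: complexI; rewrite rmorphM -[RHS]/(_%:C%C * _%:C%C) -!rnormE normrZ.
by congr (_ * _); rewrite RRe_real// normr_real.
Qed.

(** The modulus is at most |Re c| + |Im c|; this form keeps coefficients within real-valued
    measurable functions. *)
Lemma ler_rnormZ c v :
  rnorm (c *: v) <= (`|complex.Re c| + `|complex.Im c|) * rnorm v.
Proof.
rewrite rnormZ ler_wpM2r ?rnorm_ge0// normc_def /=.
rewrite -[leRHS]ger0_norm ?addr_ge0// -sqrtr_sqr; apply: ler_wsqrtr.
rewrite sqrrD !real_normK ?num_real//.
by have : 0 <= `|complex.Re c| * `|complex.Im c| by []; lra.
Qed.

Lemma rnorm_unit c v : `|c| = 1 -> rnorm (c *: v) = rnorm v.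
Proof. by move=> c1; rewrite rnormZ c1 mul1r. Qed.

End rnorm.

Definition cmeasurable {R : realType} {d} {T : measurableType d} (c : T -> R[i]) : Prop :=
  measurable_fun setT (fun t => complex.Re (c t) : measurableTypeR R) /\
  measurable_fun setT (fun t => complex.Im (c t) : measurableTypeR R).

Section cmeasurable.
Context {R : realType} {d : measure_display} {T : measurableType d}.
Implicit Types c e : T -> R[i].

Lemma cmeasurable_cst (z : R[i]) : cmeasurable (fun _ : T => z).
Proof. by split; exact: measurable_cst. Qed.

Lemma cmeasurableM c e : cmeasurable c -> cmeasurable e ->
  cmeasurable (fun t => c t * e t).
Proof.
move=> [c1 c2] [e1 e2]; split.
  rewrite (_ : (fun _ => _) = fun t =>
      complex.Re (c t) * complex.Re (e t) - complex.Im (c t) * complex.Im (e t)).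
    by apply: measurable_funB; exact: measurable_funM.
  by apply/funext => t; case: (c t); case: (e t).
rewrite (_ : (fun _ => _) = fun t =>
      complex.Re (c t) * complex.Im (e t) + complex.Im (c t) * complex.Re (e t)).
  by apply: measurable_funD; exact: measurable_funM.
by apply/funext => t; case: (c t); case: (e t).
Qed.

Lemma cmeasurableX c n : cmeasurable c -> cmeasurable (fun t => c t ^+ n).
Proof.
move=> mc; elim: n => [|n IH]; first exact: cmeasurable_cst.
rewrite (_ : (fun _ => _) = fun t => c t * c t ^+ n); first exact: cmeasurableM.
by apply/funext => t; rewrite exprS.
Qed.

Lemma cmeasurable_prod {J : Type} (s : seq J) (c : J -> T -> R[i]) :
  (forall j, cmeasurable (c j)) -> cmeasurable (fun t => \prod_(j <- s) c j t).
Proof.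
move=> mc; elim: s => [|j s IH].
  rewrite (_ : (fun _ => _) = fun=> 1); first exact: cmeasurable_cst.
  by apply/funext => t; rewrite big_nil.
rewrite (_ : (fun _ => _) = fun t => c j t * \prod_(j <- s) c j t).
  exact: cmeasurableM.
by apply/funext => t; rewrite big_cons.
Qed.

Lemma cmeasurable_comp {d'} {T' : measurableType d'} (f : T' -> T) c :
  measurable_fun setT f -> cmeasurable c -> cmeasurable (c \o f).
Proof.
by move=> mf [c1 c2]; split; [exact: measurableT_comp c1 mf|exact: measurableT_comp c2 mf].
Qed.

Context {X : completeNormedModType R[i]}.

(* X need not be separable: the norm at time t is the infimum over rational
   complex r of |u + r x_j + rest| + |c_j(t) - r| |x_j|, which removes the
   time-dependent coefficients one by one. *)
Lemma measurable_rnorm_sum {J : Type} (s : seq J) (c : J -> T -> R[i]) (x : J -> X) (u : X) :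
  (forall j, cmeasurable (c j)) ->
  measurable_fun setT
    (fun t => rnorm (u + \sum_(j <- s) c j t *: x j) : measurableTypeR R).
Proof.
(* The offset [u] varies in the induction so that it can absorb the constant vector
   [appr r *: x j]. *)
move=> mc; elim: s u => [|j s IH] u.
  rewrite (_ : (fun _ => _) = fun=> rnorm u); first exact: measurable_cst.
  by apply/funext => t; rewrite big_nil addr0.
pose rest t := \sum_(j <- s) c j t *: x j.
pose appr (r : rat * rat) : R[i] := ((ratr r.1 : R) +i* (ratr r.2 : R))%C.
pose dist t r : R :=
  `|complex.Re (c j t) - ratr r.1| + `|complex.Im (c j t) - ratr r.2|.
pose g r t : R := rnorm (u + appr r *: x j + rest t) + dist t r * rnorm (x j).
have mg r : measurable_fun setT (g r : T -> measurableTypeR R).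
  have [c1 c2] := mc j.
  apply: measurable_funD; first exact: IH.
  apply: measurable_funM => //; apply: measurable_funD.
    by apply: measurableT_comp => //; exact: measurable_funB.
  by apply: measurableT_comp => //; exact: measurable_funB.
apply: (measurability _ (RGenInftyO.measurableE R)) => //.
move=> _ [_ [a ->] <-]; rewrite setTI.
(* The norm is the infimum of the countably many [g r], so its strict sublevel set is the union of
   theirs. *)
rewrite (_ : _ @^-1` _ = \bigcup_r (g r @^-1` `]-oo, a[%classic)).
  apply: countable_bigcupT_measurable => // r.
  by rewrite -[X in measurable X]setTI; exact: mg.
have split_ t r (b : R[i]) : u + b *: x j + rest t =
    u + appr r *: x j + rest t + (b - appr r) *: x j.
  rewrite scalerBl addrACA -!addrA; congr (_ + _); rewrite addrCA; congr (_ + _).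
  by rewrite addrCA addrN addr0.
apply/seteqP; split => t /=; rewrite !in_itv /= big_cons addrA -/(rest t).
  move=> lta.
  (* Replacing the coefficient by [r] and adding the penalty each cost at most
     [2 * e * rnorm (x j)], together less than the slack below [a]. The [+ 1] covers [x j = 0]. *)
  pose e := (a - rnorm (u + c j t *: x j + rest t)) / (4 * (rnorm (x j) + 1)).
  have n0 := rnorm_ge0 (x j).
  have e0 : 0 < e by rewrite divr_gt0//; lra.
  have approx (y : R) : exists r : rat, `|y - ratr r| < e.
    have [|r] := @rat_in_itvoo R (y - e) (y + e); first by lra.
    by rewrite in_itv /= => /andP[? ?]; exists r; rewrite ltr_norml; apply/andP; split; lra.
  have [r1 h1] := approx (complex.Re (c j t)).
  have [r2 h2] := approx (complex.Im (c j t)).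
  exists (r1, r2) => //; rewrite /g.
  have k : rnorm (u + appr (r1, r2) *: x j + rest t) <=
      rnorm (u + c j t *: x j + rest t) + dist t (r1, r2) * rnorm (x j).
    rewrite -[u + appr _ *: _ + _](subrK ((c j t - appr (r1, r2)) *: x j)).
    rewrite addrAC -split_; apply: (le_trans (ler_rnormD _ _)).
    rewrite lerD2l -scaleNr; apply: (le_trans (ler_rnormZ _ _)).
    rewrite ler_wpM2r// /dist; case: (c j t) => ? ? /=.
    by rewrite !normrN.
  have k2 : dist t (r1, r2) * rnorm (x j) <= 2 * e * rnorm (x j).
    by rewrite ler_wpM2r// /dist /=; lra.
  have k3 : e * (4 * (rnorm (x j) + 1)) = a - rnorm (u + c j t *: x j + rest t).
    by rewrite mulfVK// gt_eqF//; lra.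
  rewrite /= in_itv /=; lra.
(* Conversely, every [g r] dominates the norm by the triangle inequality. *)
move=> [r _]; rewrite /g /= in_itv /=; apply: le_lt_trans.
rewrite (split_ t r (c j t)); apply: (le_trans (ler_rnormD _ _)).
rewrite lerD2l; apply: (le_trans (ler_rnormZ _ _)).
by rewrite ler_wpM2r ?rnorm_ge0// /dist; case: (c j t).
Qed.

End cmeasurable.

(** * Kronecker weights *)

Lemma big_supp {T : Type} {idx : T} {op : Monoid.com_law idx} {J : eqType}
    (r s : seq J) (F : J -> T) :
  uniq r -> uniq s -> {subset r <= s} ->
  (forall i, i \in s -> i \notin r -> F i = idx) ->
  \big[op/idx]_(i <- s) F i = \big[op/idx]_(i <- r) F i.
Proof.
move=> ur us rs F0; rewrite (bigID (mem r)) /= [X in op _ X]big1_seq.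
  rewrite Monoid.mulm1 -big_filter; apply: perm_big.
  apply: uniq_perm => //; first exact: filter_uniq.
  by move=> i; rewrite mem_filter /=; case: (boolP (i \in r)) => // /rs.
by move=> i /andP[ir ij]; exact: F0.
Qed.

(** Uniqueness of base-[d] expansions: reduction modulo [d] gives the lowest digit, which is
    cancelled before dividing by [d]. *)
Lemma radix_inj (d M : nat) (f g : nat -> nat) :
  (forall j, (f j < d)%N) -> (forall j, (g j < d)%N) ->
  (\sum_(j < M) f j * d ^ j = \sum_(j < M) g j * d ^ j)%N ->
  forall j, (j < M)%N -> f j = g j.
Proof.
elim: M f g => // M IH f g fd gd.
rewrite !big_ord_recl /= !expn0 !muln1.
have shift h : (\sum_(i < M) h (bump 0 i) * d ^ bump 0 i =
    d * \sum_(i < M) h i.+1 * d ^ i)%N.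
  by rewrite big_distrr /=; apply: eq_bigr => i _; rewrite expnS mulnCA.
rewrite !shift => e.
have d0 : (0 < d)%N by exact: leq_ltn_trans (leq0n _) (fd 0%N).
have e0 : f 0%N = g 0%N.
  have := congr1 (modn^~ d) e.
  by rewrite /= ![(d * _)%N]mulnC ![(_ 0%N + _)%N]addnC !modnMDl !modn_small.
move: e; rewrite e0 => /addnI /eqP; rewrite eqn_pmul2l// => /eqP e.
move=> [|j] // jM.
exact: (IH (fun i => f i.+1) (fun i => g i.+1)).
Qed.

Section weight.
Context {I : countType}.
Implicit Types a b : {fsfun I -> nat with 0%N}.

(** The exponent of w in z^a after the Kronecker substitution z_i = w^(d^i), with each index
    replaced by its code [pickle i]. *)
Definition weight (d : nat) a : nat :=
  (\sum_(i <- finsupp a) a i * d ^ choice.pickle i)%N.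

Lemma weight_inj d a b : (0 < d)%N -> (forall i, (a i < d)%N) -> (forall i, (b i < d)%N) ->
  weight d a = weight d b -> a = b.
Proof.
move=> d0 ad bd.
(* Digit [n] of the weight is the entry at the index coded by [n], and 0 if [n] codes no index. *)
pose dig (c : {fsfun I -> nat with 0%N}) n := oapp c 0%N (pickle_inv n).
(* All codes in both supports lie below [M], so both weights have [M]-digit expansions. *)
pose M := (\max_(i <- (finsupp a `|` finsupp b)%fset) choice.pickle i).+1.
have weightE (c : {fsfun I -> nat with 0%N}) :
    {subset finsupp c <= (finsupp a `|` finsupp b)%fset} ->
    weight d c = (\sum_(j < M) dig c j * d ^ j)%N.
  move=> cS; rewrite /weight -(big_mkord xpredT (fun j => dig c j * d ^ j)%N).
  rewrite -(@big_supp _ _ _ _ _ (pmap (@pickle_inv I) (index_iota 0 M))).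
  - rewrite big_pmap; apply: eq_bigr => j _; rewrite /dig.
    have := @pickle_invK I j.
    by case: (pickle_inv j) => [i|] //= ->.
  - exact: fset_uniq.
  - by apply: (pmap_uniq (@pickle_invK I)); exact: iota_uniq.
  - move=> i ic; rewrite mem_pmap; apply/mapP; exists (choice.pickle i).
      by rewrite mem_index_iota /= ltnS; apply: leq_bigmax_seq => //; exact: cS.
    by rewrite pickleK_inv.
  - by move=> i _ ic; rewrite fsfun_dflt.
rewrite !weightE; [|by move=> i; rewrite inE => ->; rewrite orbT|by move=> i; rewrite inE => ->].
have lt (c : {fsfun I -> nat with 0%N}) :
    (forall i, (c i < d)%N) -> forall j, (dig c j < d)%N.
  by move=> cd j; rewrite /dig; case: (pickle_inv j) => /=.
move=> e; apply/fsfunP => i.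
case: (boolP (i \in (finsupp a `|` finsupp b)%fset)) => [iab|].
  have iM : (choice.pickle i < M)%N by rewrite ltnS; apply: leq_bigmax_seq.
  have := radix_inj _ _ _ _ (lt a ad) (lt b bd) e _ iM.
  by rewrite /dig pickleK_inv.
by rewrite inE negb_or => /andP[? ?]; rewrite !fsfun_dflt.
Qed.

End weight.

(** * Fourier cotype at arbitrary distinct positive frequencies *)

Section fourier_cotype_seq.
Context {R : realType} {X : completeNormedModType R[i]} {J : choiceType}.

Lemma fourier_cotype_seq (q C : R) : q != 0 ->
  (forall (N : nat) (x : nat -> X),
    (((\sum_(1 <= k < N.+1) rnorm (x k) `^ q) `^ q^-1)%:E <=
     C%:E * bnorm (circle_prob R) (conj_exponent q)
       (fun z => \sum_(1 <= k < N.+1) cval z ^+ k *: x k)%R)%E) ->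
  forall (s : seq J) (k : J -> nat) (x : J -> X),
    uniq s -> {in s &, injective k} -> (forall j, (0 < k j)%N) ->
    (((\sum_(j <- s) rnorm (x j) `^ q) `^ q^-1)%:E <=
     C%:E * bnorm (circle_prob R) (conj_exponent q)
       (fun z => \sum_(j <- s) cval z ^+ k j *: x j)%R)%E.
Proof.
move=> q0 hC s k x us injk k0.
pose N := \max_(j <- s) k j.
(* By injectivity of [k] on [s] this sum has at most one term: it places [x j] at frequency [k j]
   and 0 in the gaps. *)
pose y n := \sum_(j <- s | k j == n) x j.
have kN j : j \in s -> k j \in index_iota 1 N.+1.
  by move=> js; rewrite mem_index_iota k0 ltnS leq_bigmax_seq.
have uk : uniq (map k s) by rewrite map_inj_in_uniq.
have yk j : j \in s -> y (k j) = x j.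
  move=> js; rewrite /y big_seq_cond.
  rewrite (eq_bigl (fun i => (i \in s) && (i == j))).
    by rewrite -big_seq_cond -big_filter filter_pred1_uniq// big_seq1.
  move=> i; case: (boolP (i \in s)) => //= si.
  by apply/eqP/eqP => [/injk|->//]; apply.
have sumE (V : nmodType) (f : nat -> X -> V) : (forall n, f n 0 = 0) ->
    \sum_(1 <= n < N.+1) f n (y n) = \sum_(j <- s) f (k j) (x j).
  move=> f0; rewrite (@big_supp _ _ _ _ (map k s)) ?iota_uniq//.
  - by rewrite big_map; apply: eq_big_seq => j js; rewrite yk.
  - by move=> _ /mapP[j js ->]; exact: kN.
  - move=> n _ nk; rewrite /y big1_seq// => j /andP[/eqP jn js].
    by case/negP: nk; apply/mapP; exists j.
have := hC N y.
(* The gaps contribute nothing to the left side because [q != 0] makes the [q]-th power of 0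
   vanish. *)
rewrite (sumE _ (fun=> fun v => rnorm v `^ q)); last first.
  by move=> _; rewrite /rnorm normr0 /= powR0.
congr (_ <= _ * bnorm _ _ _)%E; apply/funext => z.
by rewrite (sumE _ (fun n v => cval z ^+ n *: v))// => n; rewrite scaler0.
Qed.

End fourier_cotype_seq.

(** * From one variable to many *)

Lemma cval_arc_natmul {R : realType} (n : nat) (t : R) :
  cval (Defs.arc (n%:R * t)) = cval (Defs.arc t) ^+ n.
Proof.
elim: n => [|n IH].
  rewrite mul0r expr0 /cval /= /expi mulr0 cos0 sin0.
  by apply/eqP; rewrite eq_complex /= !eqxx.
by rewrite -natr1 mulrDl mul1r arcD exprS -IH.
Qed.

Section monomial.
Context {R : realType} {I : countType}.
Implicit Types a : {fsfun I -> nat with 0%N}.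

Lemma norm_monomial a (z : torus R I) : `|monomial a z| = 1.
Proof.
by rewrite normr_prod big1// => i _; rewrite normrX norm_cval expr1n.
Qed.

Lemma cmeasurable_cval : cmeasurable (fun z : circle R => cval z).
Proof. by split; [exact: measurable_Re_cval|exact: measurable_Im_cval]. Qed.

Lemma cmeasurable_monomial a : cmeasurable (fun z : torus R I => monomial a z).
Proof.
apply: cmeasurable_prod => i; apply: cmeasurableX.
exact: cmeasurable_comp (measurable_coord i) cmeasurable_cval.
Qed.

(** This links the two sides of the transfer: rotating all coordinates by suitable powers of w =
    [arc t] acts on z^a as the single frequency [weight d a]. *)
Lemma monomial_torus_mul (d : nat) (t : R) a (z : torus R I) :
  monomial a (torus_mul (fun i => Defs.arc ((d ^ choice.pickle i)%N%:R * t)) z) =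
  cval (Defs.arc t) ^+ weight d a * monomial a z.
Proof.
rewrite /monomial /weight -prodrXr -big_split /=; apply: eq_bigr => i _.
rewrite {1}/torus_mul -[cval (cmul _ _)]/(cval _ * cval _) exprMn cval_arc_natmul.
by rewrite -exprM mulnC.
Qed.

End monomial.

Lemma measurable_rnorm_sum_powR {R : realType} {X : completeNormedModType R[i]}
    {d} {T : measurableType d} {J : Type} (s : seq J) (c : J -> T -> R[i])
    (x : J -> X) (p : R) :
  (forall j, cmeasurable (c j)) ->
  measurable_fun setT
    (fun t => (rnorm (\sum_(j <- s) c j t *: x j) `^ p)%:E).
Proof.
move=> mc; apply/measurable_EFinP.
have mr : measurable_fun setT
    (fun t => rnorm (\sum_(j <- s) c j t *: x j) : measurableTypeR R).
  have := measurable_rnorm_sum s c x 0 mc.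
  by under eq_fun do rewrite add0r.
exact: measurableT_comp (measurable_powR p) mr.
Qed.

Lemma poweRVK {R : realType} (p : R) (x : \bar R) : p != 0 -> (0 <= x)%E ->
  ((x `^ p^-1) `^ p)%E = x.
Proof. by move=> p0 x0; rewrite -poweRrM mulVf// poweRe1. Qed.

Section fourier_cotype_torus.
Context {R : realType} {X : completeNormedModType R[i]} {I : countType}.
Local Open Scope ereal_scope.

(** A countable [I] serves both ['I_N] and [nat], and an arbitrary list [s] serves both full
    supports and homogeneous parts. *)
Lemma fourier_cotype_torus (q q' C : R) : q != 0%R -> (0 < q')%R -> (0 <= C)%R ->
  conj_exponent q = q' ->
  (forall (N : nat) (x : nat -> X),
    (((\sum_(1 <= k < N.+1) rnorm (x k) `^ q) `^ q^-1)%R%:E <=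
     C%:E * bnorm (circle_prob R) (conj_exponent q)
       (fun z => \sum_(1 <= k < N.+1) cval z ^+ k *: x k)%R)) ->
  forall (s : seq {fsfun I -> nat with 0%N}) (x : {fsfun I -> nat with 0%N} -> X),
    uniq s ->
    ((\sum_(a <- s) rnorm (x a) `^ q) `^ q^-1)%R%:E <=
     C%:E * bnorm (torus_prob R I) q'
       (fun z => \sum_(a <- s) monomial a z *: x a)%R.
Proof.
move=> q0 q'0 C0 qq' hC s x us.
have q'N0 : q' != 0%R by rewrite gt_eqF.
(* The base exceeds every entry of every multi-index in [s], so [weight d] is injective on [s]. *)
pose d := (\max_(a <- s) \max_(i <- finsupp a) a i).+1.
have ltd a i : a \in s -> (a i < d)%N.
  move=> sa; rewrite ltnS; case: (boolP (i \in finsupp a)) => ia; last first.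
    by rewrite fsfun_dflt.
  apply: (@leq_trans (\max_(i <- finsupp a) a i)%N); first exact: leq_bigmax_seq.
  exact: (@leq_bigmax_seq _ _ _ (fun a => \max_(i <- finsupp a) a i)%N a).
(* Fourier cotype sums over frequencies starting at 1, hence the successor. *)
pose k (a : {fsfun I -> nat with 0%N}) := (weight d a).+1.
have injk : {in s &, injective k}.
  move=> a b sa sb [] /weight_inj; apply => // i; exact: ltd.
pose S : R := ((\sum_(a <- s) rnorm (x a) `^ q) `^ q^-1)%R.
have S0 : (0 <= S)%R by exact: powR_ge0.
pose F (z : torus R I) (w : circle R) : \bar R :=
  (rnorm (\sum_(a <- s) (cval w ^+ k a * monomial a z) *: x a)%R `^ q')%R%:E.
pose G (z : torus R I) : \bar R :=
  (rnorm (\sum_(a <- s) monomial a z *: x a)%R `^ q')%R%:E.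
have F0 z w : 0 <= F z w by rewrite lee_fin powR_ge0.
have G0 z : 0 <= G z by rewrite lee_fin powR_ge0.
have mG : measurable_fun setT G.
  by apply: measurable_rnorm_sum_powR => a; exact: cmeasurable_monomial.
have mFw z : measurable_fun setT (F z).
  apply: measurable_rnorm_sum_powR => a; apply: cmeasurableM.
    by apply: cmeasurableX; exact: cmeasurable_cval.
  exact: cmeasurable_cst.
(* Tonelli is applied with the angle [t] in place of the circle variable, which needs joint
   measurability in [(z, t)]. *)
have mF : measurable_fun setT
    (fun zt : torus R I * measurableTypeR R => F zt.1 (Defs.arc zt.2)).
  apply: measurable_rnorm_sum_powR => a; apply: cmeasurableM.
    apply: cmeasurableX.
    apply: (cmeasurable_comp
      (fun zt : torus R I * measurableTypeR R => Defs.arc zt.2) _ _ cmeasurable_cval).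
    exact: (measurableT_comp (@measurable_arc R)).
  exact: (cmeasurable_comp fst _ _ (cmeasurable_monomial a)).
(* The successor in [k] only contributes a common factor [arc t] of modulus 1, which the norm
   ignores. *)
have rot z t : F z (Defs.arc t) =
    G (torus_mul (fun i => Defs.arc ((d ^ choice.pickle i)%N%:R * t)) z).
  rewrite /F /G; congr ((_ `^ _)%R%:E).
  rewrite -[RHS](rnorm_unit (cval (Defs.arc t))) ?norm_cval//.
  rewrite scaler_sumr; congr rnorm; apply: eq_bigr => a _.
  by rewrite scalerA monomial_torus_mul /k exprS mulrA.
pose P : probability (measurableTypeR R) R := uniform_prob (@ltr01 R).
have circleE z : \int[circle_prob R]_w F z w = \int[P]_t F z (Defs.arc t).
  by rewrite /circle_prob ge0_integral_distribution.
(* For fixed [z] the vectors [monomial a z *: x a] have the norms of the [x a], so the left side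
   does not depend on [z]. *)
have pointwise z : (S `^ q')%:E <= (C `^ q')%:E * \int[P]_t F z (Defs.arc t).
  have := fourier_cotype_seq _ _ q0 hC s k (fun a => monomial a z *: x a)%R us injk (fun=> isT).
  under [X in (X `^ _)%R%:E]eq_bigr do rewrite rnorm_unit ?norm_monomial//.
  rewrite -/S qq' /bnorm.
  under eq_integral do under eq_bigr do rewrite scalerA.
  rewrite circleE => h.
  have int0 : 0 <= \int[P]_t F z (Defs.arc t) by exact: integral_ge0.
  rewrite -2!poweR_EFin -[X in _ * X](@poweRVK _ q')// -poweRM ?poweR_ge0//.
  apply: gt0_ler_poweR => //; first exact: ltW.
    by rewrite in_itv /= leey lee_fin S0.
  by rewrite in_itv /= leey andbT mule_ge0// poweR_ge0.
pose K : \bar R := \int[torus_prob R I]_z G z.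
have K0 : 0 <= K by exact: integral_ge0.
have total : (S `^ q')%:E <= (C `^ q')%:E * K.
  rewrite -[leLHS]mule1 -(@probability_setT _ _ _ (torus_prob R I)) -integral_cst//.
  apply: (@le_trans _ _ (\int[torus_prob R I]_z
      ((C `^ q')%:E * \int[P]_t F z (Defs.arc t)))).
    apply: ge0_le_integral => //.
    - by move=> z _; rewrite lee_fin powR_ge0.
    - by apply: measurable_funeM; exact: (measurable_fun_fubini_tonelli_F _ mF).
  rewrite ge0_integralZl//; last 3 first.
  - exact: (measurable_fun_fubini_tonelli_F _ mF).
  - by move=> z _; exact: integral_ge0.
  - by rewrite lee_fin powR_ge0.
  rewrite lee_wpmul2l// ?lee_fin ?powR_ge0//.
  rewrite (fubini_tonelli _ mF)//=.
  (* After the exchange, rotation invariance makes the inner integral over [z] equal to [K] for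
     every [t]. *)
  rewrite (eq_integral (cst K)); last first.
    by move=> t _; under eq_integral do rewrite rot; exact: ge0_integral_torus_mul.
  have -> : \int[P]_t cst K t = K * P setT by exact: integral_cst.
  by rewrite (probability_setT P) mule1.
have SE : S%:E = (S `^ q')%:E `^ q'^-1.
  by rewrite -poweR_EFin -poweRrM divff// poweRe1.
have CE : C%:E = (C `^ q')%:E `^ q'^-1.
  by rewrite -poweR_EFin -poweRrM divff// poweRe1.
rewrite -/S SE CE /bnorm -/K -poweRM ?lee_fin ?powR_ge0//.
apply: gt0_ler_poweR total; first by rewrite invr_ge0 ltW.
  by rewrite in_itv /= leey lee_fin powR_ge0.
by rewrite in_itv /= leey andbT mule_ge0// lee_fin powR_ge0.
Qed.

End fourier_cotype_torus.

(** * Comparison of L^p norms on a probability space *)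

Section bnorm_le.
Context {R : realType} {X : completeNormedModType R[i]}.
Local Open Scope ereal_scope.

(** Hölder's inequality for the [p]-th power of the norm against the constant 1, with exponent
    [2 / p]. *)
Lemma bnorm_le2 {d} {T : measurableType d} (mu : probability T R) (p : R) (f : T -> X) :
  (0 < p <= 2)%R -> measurable_fun setT (fun t => rnorm (f t) : measurableTypeR R) ->
  bnorm mu p f <= bnorm mu 2 f.
Proof.
(* The case [p = 2] is split off since [r = 1] has no finite conjugate exponent. *)
move=> /andP[p0]; rewrite le_eqVlt => /predU1P[-> //|p2] mf.
pose r := (2 / p)%R; pose r' := ((1 - r^-1)^-1)%R.
have r0 : (0 < r)%R by rewrite divr_gt0.
have rV : (r^-1 = p / 2)%R by rewrite /r invf_div.
have r'0 : (0 < r')%R by rewrite invr_gt0 rV; lra.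
have rr' : (r^-1 + r'^-1 = 1)%R by rewrite invrK; ring.
pose g t := (rnorm (f t) `^ p)%R.
have mg : measurable_fun setT (g : T -> measurableTypeR R).
  exact: measurableT_comp (measurable_powR p) mf.
have g0 t : (0 <= g t)%R by exact: powR_ge0.
have := @hoelder _ _ _ mu g (cst 1%R) r r' mg (measurable_cst _) r0 r'0 rr'.
have -> : 'N[mu]_r'%:E[EFin \o cst 1%R] = 1.
  rewrite -[RHS](poweR1r r'^-1) -(probability_setT mu).
  exact: Lnorm_cst1.
rewrite Lnorm1 mule1.
have -> : \int[mu]_t `|(EFin \o (g \* cst 1)%R) t| = \int[mu]_t (g t)%:E.
  by apply: eq_integral => t _; rewrite /= mulr1 ger0_norm.
have -> : 'N[mu]_r%:E[EFin \o g] =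
    (\int[mu]_t (rnorm (f t) `^ 2)%:E) `^ (p / 2).
  rewrite unlock -rV; congr (_ `^ _); apply: eq_integral => t _.
  rewrite /= ger0_norm// -powRrM /r.
  by rewrite mulrCA divff ?mulr1// gt_eqF.
move=> h.
rewrite /bnorm (_ : 2^-1 = (p / 2) * p^-1)%R; last by field; rewrite gt_eqF.
rewrite poweRrM; apply: gt0_ler_poweR h; first by rewrite invr_ge0 ltW.
  by rewrite in_itv /= leey andbT; apply: integral_ge0 => t _; rewrite lee_fin.
by rewrite in_itv /= leey andbT poweR_ge0.
Qed.

End bnorm_le.

(** * Deduction of both cotype inequalities from the torus estimate *)

Theorem proposition2p4 (R : realType) (q q' : R) (X : completeNormedModType R[i])
    (hq : 2 <= q) (hqq' : q^-1 + q'^-1 = 1) (hX : fourier_cotype X q) :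
  (exists2 C : R, 0 < C &
    forall (N : nat) (x : {fsfun {fsfun 'I_N -> nat with 0%N} -> X with 0}),
      (0 < N)%N ->
      (((\sum_(a <- finsupp x) rnorm (x a) `^ q) `^ q^-1)%:E <=
       C%:E * bnorm (torus_prob R 'I_N) q'
         (fun z => \sum_(a <- finsupp x) monomial a z *: x a)%R)%E) /\
  hypercontractive_homogeneous_cotype X q.
Proof.
case: hX => C C0 hC.
have q0 : q != 0 by rewrite gt_eqF//; lra.
have qV2 : q^-1 <= 2^-1 by rewrite lef_pV2 ?posrE//; lra.
have q'E : conj_exponent q = q'.
  by rewrite /conj_exponent -[q']invrK; congr (_^-1); lra.
have q'0 : 0 < q' by rewrite -q'E invr_gt0; lra.
have q'2 : q' <= 2.
  by rewrite -q'E -[leRHS]invrK lef_pV2 ?posrE; lra.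
split.
  exists C => // N x _.
  by apply: fourier_cotype_torus q0 q'0 (ltW C0) q'E hC _ _ _; exact: fset_uniq.
(* A base at least 1 makes its [m]-th power dominate [C] for every [m >= 1]. *)
exists (Num.max C 1); first by rewrite lt_max C0.
move=> m x m0.
have hle : C <= Num.max C 1 ^+ m.
  apply: (@le_trans _ _ (Num.max C 1)); first by rewrite le_max lexx.
  by rewrite ler_eXnr // le_max lexx orbT.
(* The degree condition moves into the list, so that the torus estimate applies to the homogeneous
   part. *)
rewrite -big_filter; under [X in bnorm _ _ X]eq_fun do rewrite -big_filter.
set s := [seq i <- _ | _].
apply: (le_trans (fourier_cotype_torus q q' C q0 q'0 (ltW C0) q'E hC s x _)).
  by rewrite filter_uniq ?fset_uniq.
apply: lee_pmul.
- by rewrite lee_fin ltW.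
- exact: poweR_ge0.
- by rewrite lee_fin.
apply: bnorm_le2; first by rewrite q'0.
have := measurable_rnorm_sum s _ (fun a => x a) 0 (@cmeasurable_monomial R nat).
by under eq_fun do rewrite add0r.
Qed.
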